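(* Let $\mu$ be a sigma-finite Borel measure on $\mathbb{R}$, let $U\subset\mathbb{R}$ be a Borel subset with $\mu(\mathbb{R}\setminus U)=0$, and let $H$ be a reproducing kernel subspace in $L^2(\mathbb{R},\mu)$ (of functions on $U$) with reproducing kernel $K$. Assume that for any $k\in U$ and any $f\in H$ satisfying $f(k)=0$ there exists a unique function $g\in H$ such that $f(x)=(x-k)g(x)$ for all $x\in U$. Then there exist functions $A,B:U\to\mathbb{C}$ such that for all $x,y\in U$ with $x\neq y$, $$K(x,y)=\frac{A(x)\overline{B(y)}-B(x)\overline{A(y)}}{x-y}.$$
   Context: Functions are complex-valued. A linear set $H$ of Borel functions $f$ on $U$ (actual functions, not equivalence classes) satisfying $\int|f|^2\,d\mu<\infty$ is called a reproducing kernel subspace in $L^2(\mathbb{R},\mu)$ if it is closed in the $L^2(\mathbb{R},\mu)$ norm and, for every $k\in U$, the functional $f\mapsto f(k)$ on $H$ is bounded in the $L^2(\mathbb{R},\mu)$ norm. For $w\in U$, the reproducing kernel at $w$ is the element $K_w=K(\cdot,w)\in H$ with $f(w)=\langle f,K_w\rangle$ for all $f\in H$, where $\langle f,g\rangle=\int f\overline{g}\,d\mu$; thus $K(x,y)=K_y(x)$. *)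

(* Defs.v *)
From mathcomp Require Import all_boot all_order all_algebra.
From mathcomp Require Import complex.
From mathcomp Require Import all_classical all_reals all_analysis.

Set Implicit Arguments.
Unset Strict Implicit.
Unset Printing Implicit Defensive.

Import Order.TTheory GRing.Theory Num.Theory.

Local Open Scope classical_set_scope.
Local Open Scope ring_scope.
Local Open Scope complex_scope.

Section ReproducingKernel.
Context {R : realType}.
Variable mu : {measure set (measurableTypeR R) -> \bar R}.
Variable U : set R.
Implicit Types (f g : U -> R[i]) (H : set (U -> R[i])).

(* A function on U is a function on the type of elements of U, so that it is
   determined by its values on U only and [=] is equality of functions on U;
   it is integrated and measured through its extension by 0 to the line. *)
Definition extend0 f : R -> R[i] := 'valL_ 0 f.

Definition borel_on f : Prop :=
  measurable_fun [set: measurableTypeR R] (fun x => complex.Re (extend0 f x)) /\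
  measurable_fun [set: measurableTypeR R] (fun x => complex.Im (extend0 f x)).

Definition square_integrable f : Prop :=
  (\int[mu]_x (Normc.normc (extend0 f x) ^+ 2)%:E < +oo)%E.

Definition L2norm f : \bar R :=
  Lnorm mu 2%:E (fun x => (Normc.normc (extend0 f x))%:E).

Definition inner f g : R[i] :=
  let h x := extend0 f x * (extend0 g x)^* in
  (\int[mu]_x complex.Re (h x)) +i* (\int[mu]_x complex.Im (h x)).

Definition linear_set H : Prop :=
  H (fun=> 0) /\
  forall (a : R[i]) f g, H f -> H g -> H (fun x => a * f x + g x).

(* The classes of the elements of H form a closed subset of L^2: a limit is
   only determined, hence only required to be in H, up to a null set. *)
Definition L2closed H : Prop :=
  forall f, borel_on f -> square_integrable f ->
    (forall e : R, 0 < e ->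
       exists2 h, H h & (L2norm (fun x => (f x - h x)%R) < e%:E)%E) ->
    exists2 g, H g & {ae mu, forall x, extend0 f x = extend0 g x}.

Definition bounded_evaluation H (k : U) : Prop :=
  exists M : R, forall f, H f -> ((Normc.normc (f k))%:E <= M%:E * L2norm f)%E.

Definition rk_subspace H : Prop :=
  [/\ linear_set H,
      forall f, H f -> borel_on f /\ square_integrable f,
      L2closed H &
      forall k : U, bounded_evaluation H k].

Definition reproducing_kernel H (K : U -> U -> R[i]) : Prop :=
  forall w : U, H (K^~ w) /\ forall f, H f -> f w = inner f (K^~ w).

End ReproducingKernel.

(* Main.v *)
Require Import Defs.
From mathcomp Require Import all_boot all_order all_algebra.
From mathcomp Require Import complex ring lra.
From mathcomp Require Import all_classical all_reals all_analysis.
From mathcomp Require Import measurable_realfun.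

(** Choose k with K(k,k) <> 0 (if there is none, positivity forces K = 0), and
    let c_w = K(k,w) / K(k,k).  Since K_w - c_w K_k vanishes at k, it equals
    (x-k) G_w with G_w in H; put v_w = K_w / (w-k) - G_w for w <> k.  As
    multiplication by x - k is symmetric, every f = (x-k) g with f, g in H
    satisfies <f, v_w> = conj c_w * g(k).  Uniqueness of the division gives
    w0 <> k with c_w0 <> 0, for otherwise K_k would be a nonzero element of H
    annihilated by x - k.  Now c_w0 v_w - c_w v_w0 is orthogonal to every
    element of H vanishing at k, hence is a multiple of K_k.  Multiplying by
    x - k, this reads (x-w) K(x,w) = a(x) conj(b(w)) + b(x) q(w) with
    b(x) = (x-k) K_k(x), and skew-Hermitian symmetry of the left-hand side
    determines q. *)

Set Implicit Arguments.
Unset Strict Implicit.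
Unset Printing Implicit Defensive.

Import Order.TTheory GRing.Theory Num.Theory.

Local Open Scope classical_set_scope.
Local Open Scope complex_scope.
Local Open Scope ring_scope.

(* Unlike [rmorphM] followed by [/=], these do not unfold [Num.conj] at
   [R[i]]. *)
Lemma conjM {C : numClosedFieldType} (x y : C) : (x * y)^* = x^* * y^*.
Proof. exact: rmorphM. Qed.

Lemma conjD {C : numClosedFieldType} (x y : C) : (x + y)^* = x^* + y^*.
Proof. exact: rmorphD. Qed.

Lemma conjN {C : numClosedFieldType} (x : C) : (- x)^* = - x^*.
Proof. exact: rmorphN. Qed.

Lemma conjV {C : numClosedFieldType} (x : C) : (x^-1)^* = x^* ^-1.
Proof. exact: fmorphV. Qed.

Lemma conj_realc {R : rcfType} (x : R) : (x%:C : R[i])^* = x%:C.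
Proof. exact: conjc_real. Qed.

(** Expand the squares of a ± c and b ± d. This gives the majorant |f|^2 + |g|^2 for the real and
    imaginary parts of f conj(g). *)
Lemma ler_norm_dot2 {R : realFieldType} (a b c d : R) :
  `|a * c + b * d| <= a ^+ 2 + b ^+ 2 + (c ^+ 2 + d ^+ 2).
Proof.
have [p q] := (sqr_ge0 (a + c), sqr_ge0 (b + d)).
have [r s] := (sqr_ge0 (a - c), sqr_ge0 (b - d)).
have [a0 b0] := (sqr_ge0 a, sqr_ge0 b).
have [c0 d0] := (sqr_ge0 c, sqr_ge0 d).
by rewrite ler_norml; apply/andP; split; nra.
Qed.

(** * The sesquilinear form [inner] on functions on U *)

Section Inner.
Context {R : realType} {mu : {measure set (measurableTypeR R) -> \bar R}}.
Context {U : set R}.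
Implicit Types f g h : U -> R[i].

Lemma extend0_in f (u : U) : extend0 f (val u) = f u.
Proof. by rewrite -[in RHS](valLK 0 f). Qed.

Lemma extend0_out f x : ~ U x -> extend0 f x = 0.
Proof.
by move=> Ux; rewrite /extend0 /= oinv_set_val insubN// notin_setE.
Qed.

(** Carries pointwise identities on U over to the line; off U all three extensions vanish, so
    [F x 0 0 = 0] settles that case. *)
Lemma extend0P f g h (F : R -> R[i] -> R[i] -> R[i]) :
  (forall x, F x 0 0 = 0) -> (forall u : U, f u = F (val u) (g u) (h u)) ->
  forall x, extend0 f x = F x (extend0 g x) (extend0 h x).
Proof.
move=> F0 fF x; have [Ux|Ux] := pselect (U x); last by rewrite !extend0_out.
have -> : x = val (SigSub (mem_set Ux)) by [].
by rewrite !extend0_in.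
Qed.

Lemma extend0_linear (a : R[i]) f g x :
  extend0 (fun u => a * f u + g u) x = a * extend0 f x + extend0 g x.
Proof.
by apply: (@extend0P _ _ _ (fun _ y z => a * y + z)) => // y; rewrite mulr0 addr0.
Qed.

Lemma square_integrable_norm f : borel_on f -> square_integrable mu f ->
  mu.-integrable setT (EFin \o (fun x =>
    complex.Re (extend0 f x) ^+ 2 + complex.Im (extend0 f x) ^+ 2)).
Proof.
move=> [mRe mIm] sf.
have m2 : measurable_fun setT (fun x : measurableTypeR R =>
    complex.Re (extend0 f x) ^+ 2 + complex.Im (extend0 f x) ^+ 2).
  by apply: measurable_funD; apply: measurable_funX.
apply/integrableP; split; first exact/measurable_EFinP.
apply: le_lt_trans sf; rewrite le_eqVlt; apply/orP; left; apply/eqP.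
apply: eq_integral => x _ /=; congr EFin.
case: (extend0 f x) => a b /=; rewrite sqr_sqrtr ?addr_ge0 ?sqr_ge0//.
by rewrite ger0_norm ?addr_ge0 ?sqr_ge0.
Qed.

Lemma inner_integrable f g :
    borel_on f -> square_integrable mu f ->
    borel_on g -> square_integrable mu g ->
  let h x := extend0 f x * (extend0 g x)^* in
  mu.-integrable setT (EFin \o (fun x => complex.Re (h x))) /\
  mu.-integrable setT (EFin \o (fun x => complex.Im (h x))).
Proof.
move=> bf sf bg sg h.
have ifg := integrableD measurableT (square_integrable_norm bf sf)
  (square_integrable_norm bg sg).
have [[mf1 mf2] [mg1 mg2]] := (bf, bg).
pose f1 x := complex.Re (extend0 f x); pose f2 x := complex.Im (extend0 f x).
pose g1 x := complex.Re (extend0 g x); pose g2 x := complex.Im (extend0 g x).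
have hRe : (fun x => complex.Re (h x)) = (fun x => f1 x * g1 x + f2 x * g2 x).
  apply/funext => x; rewrite /h /f1 /f2 /g1 /g2.
  by case: (extend0 f x) (extend0 g x) => a b [c d] /=; rewrite mulrN opprK.
have hIm : (fun x => complex.Im (h x)) = (fun x => f2 x * g1 x - f1 x * g2 x).
  apply/funext => x; rewrite /h /f1 /f2 /g1 /g2.
  by case: (extend0 f x) (extend0 g x) => a b [c d] /=; ring.
split; apply: (le_integrable measurableT _ _ ifg).
- apply/measurable_EFinP; rewrite hRe.
  by apply: measurable_funD; apply: measurable_funM.
- move=> x _; rewrite /= lee_fin (congr1 (@^~ x) hRe) [leRHS]ger0_norm.
    exact: ler_norm_dot2.
  by rewrite !addr_ge0 ?sqr_ge0.
- apply/measurable_EFinP; rewrite hIm.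
  by apply: measurable_funB; apply: measurable_funM.
- move=> x _; rewrite /= lee_fin (congr1 (@^~ x) hIm) [leRHS]ger0_norm.
    rewrite -mulNr; apply: le_trans (ler_norm_dot2 _ _ _ _) _.
    by rewrite sqrrN [X in X + _]addrC.
  by rewrite !addr_ge0 ?sqr_ge0.
Qed.

(** Real and imaginary parts are expanded separately; [inner_integrable] justifies splitting each
    integral. *)
Lemma inner_linear (a : R[i]) f g h :
    borel_on f -> square_integrable mu f ->
    borel_on g -> square_integrable mu g ->
    borel_on h -> square_integrable mu h ->
  inner mu (fun x => a * f x + g x) h = a * inner mu f h + inner mu g h.
Proof.
move=> bf sf bg sg bh sh.
have [ifh1 ifh2] := inner_integrable bf sf bh sh.
have [igh1 igh2] := inner_integrable bg sg bh sh.
case: a => a1 a2; rewrite /inner.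
set p := fun x => extend0 f x * (extend0 h x)^*.
set q := fun x => extend0 g x * (extend0 h x)^*.
have pq x : extend0 (fun u => (a1 +i* a2) * f u + g u) x * (extend0 h x)^* =
    (a1 +i* a2) * p x + q x by rewrite extend0_linear /p /q; ring.
have iZ b (G : R -> R) : mu.-integrable setT (EFin \o G) ->
    mu.-integrable setT (EFin \o (fun x => b * G x)).
  by move=> iG; apply: (integrableZl measurableT b iG).
have iD (G1 G2 : R -> R) : mu.-integrable setT (EFin \o G1) ->
    mu.-integrable setT (EFin \o G2) ->
    mu.-integrable setT (EFin \o (fun x => G1 x + G2 x)).
  by move=> i1 i2; apply: (integrableD measurableT i1 i2).
have Re_pq x : complex.Re (extend0 (fun u => (a1 +i* a2) * f u + g u) x *
      (extend0 h x)^*) =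
    (a1 * complex.Re (p x) + (- a2) * complex.Im (p x)) + complex.Re (q x).
  by rewrite pq; case: (p x) (q x) => ? ? [? ?] /=; ring.
have Im_pq x : complex.Im (extend0 (fun u => (a1 +i* a2) * f u + g u) x *
      (extend0 h x)^*) =
    (a1 * complex.Im (p x) + a2 * complex.Re (p x)) + complex.Im (q x).
  by rewrite pq; case: (p x) (q x) => ? ? [? ?] /=; ring.
rewrite (eq_Rintegral mu (fun x _ => Re_pq x)).
rewrite (eq_Rintegral mu (fun x _ => Im_pq x)).
have i11 := iZ a1 _ ifh1; have i12 := iZ (- a2) _ ifh2.
have i21 := iZ a1 _ ifh2; have i22 := iZ a2 _ ifh1.
rewrite RintegralD//; last exact: iD.
rewrite RintegralD//; rewrite !RintegralZl//.
rewrite RintegralD//; last exact: iD.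
rewrite RintegralD//; rewrite !RintegralZl//.
by apply/eqP; rewrite eq_complex /=; apply/andP; split; apply/eqP; ring.
Qed.

Lemma inner_conj f g :
    borel_on f -> square_integrable mu f ->
    borel_on g -> square_integrable mu g ->
  inner mu g f = (inner mu f g)^*.
Proof.
move=> bf sf bg sg.
have [_ ifg] := inner_integrable bf sf bg sg.
rewrite /inner /=; congr (_ +i* _).
  apply: eq_Rintegral => x _.
  by case: (extend0 f x) (extend0 g x) => a b [c d] /=; ring.
rewrite -mulN1r -RintegralZl//; apply: eq_Rintegral => x _.
by case: (extend0 f x) (extend0 g x) => a b [c d] /=; ring.
Qed.

Lemma Re_inner_ge0 f : 0 <= complex.Re (inner mu f f).
Proof.
apply: Rintegral_ge0 => x _; case: (extend0 f x) => a b /=.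
by rewrite mulrN opprK addr_ge0// -expr2 sqr_ge0.
Qed.

(** The factor x - k is real, so it passes through the conjugation and the two integrands agree
    pointwise. *)
Lemma inner_mul_sym (k : R) f f' g g' :
    (forall x : U, f x = (val x - k)%:C * g x) ->
    (forall x : U, f' x = (val x - k)%:C * g' x) ->
  inner mu f g' = inner mu g f'.
Proof.
move=> fg fg'.
have fgE x : extend0 f x * (extend0 g' x)^* = extend0 g x * (extend0 f' x)^*.
  have E u v : (forall y : U, u y = (val y - k)%:C * v y) ->
      extend0 u x = (x - k)%:C * extend0 v x.
    move=> uv.
    by apply: (@extend0P u v v (fun x y _ => (x - k)%:C * y)) => // y; rewrite mulr0.
  by rewrite (E f g fg) (E f' g' fg') conjM conj_realc; ring.
by rewrite /inner; congr (_ +i* _); apply: eq_Rintegral => x _; rewrite fgE.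
Qed.

End Inner.

(** * Algebra of skew-Hermitian and positive kernels *)

(** With q = r - conj(a), the terms in a alone form a skew-Hermitian kernel, so the remainder b(x)
    r(w) is skew-Hermitian too. This forces r to be an imaginary multiple of conj(b), which can be
    absorbed into a. *)
Lemma skew_rank_two {R : realType} {T : Type} (L : T -> T -> R[i])
    (a b q : T -> R[i]) (t0 : T) :
    (forall x w, L x w = a x * (b w)^* + b x * q w) ->
    (forall x w, L w x = - (L x w)^*) -> b t0 != 0 ->
  exists A : T -> R[i], forall x w, L x w = A x * (b w)^* - b x * (A w)^*.
Proof.
move=> LE skew b0.
have b0' : (b t0)^* != 0 by rewrite conjC_eq0.
pose r x := q x + (a x)^*.
have rE x w : b w * r x = - ((b x)^* * (r w)^*).
  have := skew x w; rewrite !LE /r !(conjD, conjM) !conjCK => /eqP E.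
  apply/eqP; rewrite -subr_eq0; move: E; rewrite -subr_eq0; congr (_ == _); ring.
(* Freezing one variable at [t0] in [rE] gives r = t conj(b). *)
pose t := r t0 / (b t0)^*.
have tJ : t^* = - t.
  rewrite /t conjM conjV conjCK.
  have E := rE t0 t0; apply: (mulfI b0); apply: (mulfI b0').
  transitivity ((b t0)^* * (r t0)^*); first by field.
  by rewrite -[LHS]opprK -E; field.
have qE x : q x = t * (b x)^* - (a x)^*.
  suff: r x = t * (b x)^* by rewrite /r => <-; ring.
  apply: (mulfI b0); rewrite rE.
  have := rE t0 t0 => E.
  transitivity ((b x)^* * (- ((b t0)^* * (r t0)^*)) / (b t0)^*); first by field.
  by rewrite -E /t; field.
(* Since conj(t) = - t, each half of t contributes equally to t b(x) conj(b(w)). *)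
clearbody t; exists (fun x => a x + t / 2 * b x) => x w.
by rewrite LE qE !(conjD, conjM) tJ conjV conjC_nat; field.
Qed.

(** Degenerate case of the Cauchy-Schwarz bound |K(x,y)|^2 <= K(x,x) K(y,y). *)
Lemma kernel_eq0 {R : realType} (mu : {measure set (measurableTypeR R) -> \bar R})
    {U : set R} (H : set (U -> R[i])) (K : U -> U -> R[i]) :
    rk_subspace mu H -> reproducing_kernel mu H K ->
  (forall x, K x x = 0) -> forall x y, K x y = 0.
Proof.
move=> [[_ Hlin] HL2 _ _] HK K0 x y.
have [HKx repx] := HK x; have [HKy repy] := HK y.
have innerKl u f : H f -> inner mu (K^~ u) f = (f u)^*.
  have [HKu repu] := HK u.
  move=> Hf; have [[? ?] [? ?]] := (HL2 _ Hf, HL2 _ HKu).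
  by rewrite (repu _ Hf); apply: inner_conj.
(* With this c the squared norm of K_x + c K_y is - 2 |K(x,y)|^2. *)
pose c := - (K x y)^*.
have Hf := Hlin c _ _ HKy HKx.
have := Re_inner_ge0 (mu := mu) (fun z => c * K z y + K z x).
have [[? ?] [? ?] [? ?]] := And3 (HL2 _ Hf) (HL2 _ HKy) (HL2 _ HKx).
rewrite inner_linear//.
rewrite (innerKl x _ Hf) (innerKl y _ Hf) !K0.
have KJ : (K y x)^* = K x y.
  by rewrite (repx _ HKy) innerKl.
rewrite mulr0 add0r addr0 KJ conjM /c conjN conjCK mulNr [X in _ + X]mulNr.
case: (K x y) => u v /= h.
have u0 : u = 0 by apply/eqP; rewrite -sqrf_eq0 eq_le sqr_ge0 andbT; nra.
have v0 : v = 0 by apply/eqP; rewrite -sqrf_eq0 eq_le sqr_ge0 andbT; nra.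
by rewrite u0 v0.
Qed.

Theorem theorem2p1 (R : realType)
    (mu : {sigma_finite_measure set (measurableTypeR R) -> \bar R})
    (U : set R) (mU : measurable (U : set (measurableTypeR R)))
    (muU : mu (~` U) = 0%E)
    (H : set (U -> R[i])) (HH : rk_subspace mu H)
    (K : U -> U -> R[i]) (HK : reproducing_kernel mu H K)
    (division : forall (k : U) (f : U -> R[i]), H f -> f k = 0 ->
       exists! g : U -> R[i],
         H g /\ forall x : U, f x = (val x - val k)%:C * g x) :
  exists A B : U -> R[i], forall x y : U, x != y ->
    K x y = (A x * (B y)^* - B x * (A y)^* ) / (val x - val y)%:C.
Proof.
have [K0|/existsNP[k /eqP Kk]] := pselect (forall x, K x x = 0).
  exists (fun=> 0), (fun=> 0) => x y _.
  by rewrite (kernel_eq0 HH HK)// !mul0r subr0 mul0r.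

(* Sesquilinearity within H and Hermitian symmetry of K *)
have [[H0 Hlin] HL2 _ _] := HH.
have HKx x : H (K^~ x) by case: (HK x).
have rep x f : H f -> f x = inner mu f (K^~ x) by case: (HK x) => _; apply.
have ipC f g : H f -> H g -> inner mu g f = (inner mu f g)^*.
  by move=> /HL2[? ?] /HL2[? ?]; apply: inner_conj.
have ipDl a f g h : H f -> H g -> H h ->
    inner mu (fun x => a * f x + g x) h = a * inner mu f h + inner mu g h.
  by move=> /HL2[? ?] /HL2[? ?] /HL2[? ?]; apply: inner_linear.
have H2 a b f g : H f -> H g -> H (fun x => a * f x + b * g x).
  move=> Hf Hg; apply: (Hlin a f (fun x => b * g x)) => //.
  have -> : (fun x => b * g x) = (fun x => b * g x + 0).
    by apply/funext => x; rewrite addr0.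
  exact: (Hlin b g (fun=> 0)).
have ip0l h : H h -> inner mu (fun=> 0) h = 0.
  move=> Hh; rewrite -[RHS](addNr (inner mu (fun=> 0) h)) -mulN1r -ipDl//.
  by congr (inner mu _ h); apply/funext => x; rewrite mulr0 addr0.
have ip2l a b f g h : H f -> H g -> H h ->
    inner mu (fun x => a * f x + b * g x) h = a * inner mu f h + b * inner mu g h.
  move=> Hf Hg Hh; rewrite (ipDl a f (fun x => b * g x))//.
    congr (_ + _); rewrite -[RHS]addr0 -(ip0l h)// -ipDl//.
    by congr (inner mu _ h); apply/funext => x; rewrite addr0.
  by have := H2 0 b _ _ H0 Hg; under eq_fun do rewrite mul0r add0r.
have ip2r a b f g h : H f -> H g -> H h ->
    inner mu h (fun x => a * f x + b * g x) =
    a^* * inner mu h f + b^* * inner mu h g.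
  move=> Hf Hg Hh; rewrite ipC// ?ip2l//; last exact: H2.
  by rewrite conjD !conjM -!ipC.
have KJ x y : K y x = (K x y)^*.
  by rewrite (rep y (K^~ x))// ipC// -(rep x (K^~ y)).
have KkJ : (K k k)^* = K k k by rewrite -KJ.
have valB_neq0 (x y : U) : x != y -> (val x - val y)%:C != 0 :> R[i].
  by move=> xy; rewrite eq_complex /= eqxx andbT subr_eq0 (inj_eq val_inj).

(* Elements of H vanishing at k *)
pose c w := K k w / K k k.
have cJ w : (c w)^* = K w k / K k k.
  by rewrite /c conjM conjV KkJ -KJ.
pose h w x := - c w * K x k + 1 * K x w.
have Hh w : H (h w) by apply: H2.
have hk w : h w k = 0 by rewrite /h /c; field.
(* Testing z against [h x] and using the reproducing property on both terms yields conj(z(x)) = c(x)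
   conj(z(k)). *)
have orth z : H z -> (forall f, H f -> f k = 0 -> inner mu f z = 0) ->
    forall x, z x = z k / K k k * K x k.
  move=> Hz zperp x.
  have := zperp _ (Hh x) (hk x).
  rewrite ip2l// mul1r ipC// -rep// (ipC z)// -rep//.
  move=> /(congr1 Num.conj); rewrite conjC0 conjD !conjM conjN !conjCK cJ.
  by move=> E; apply/eqP; rewrite -subr_eq0 -[X in _ == X]E; apply/eqP; ring.
have [w0 [w0k Kw0]] : exists w0, w0 != k /\ K w0 k != 0.
  apply: contrapT => nw; move/eqP: Kk; apply.
  have [g [_ gP]] := division k _ H0 (erefl _).
  (* Both 0 and K_k are quotients of the zero function by x - k, so uniqueness gives K_k = 0. *)
  have E1 := gP _ (conj H0 (fun x => esym (mulr0 _))).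
  suff E2 : g = K^~ k by rewrite -[LHS](congr1 (@^~ k) E2) E1.
  apply: gP; split=> // x; have [->|xk] := eqVneq x k; first by rewrite subrr mul0r.
  have [->|Kx] := eqVneq (K x k) 0; first by rewrite mulr0.
  by case: nw; exists x.
have c0 : c w0 != 0 by rewrite mulf_neq0 ?invr_eq0// KJ conjC_eq0.

(* The vectors v_w *)
have vP w : w != k -> exists v, [/\ H v,
    forall x, (val x - val k)%:C * v x =
      (val x - val w)%:C / (val w - val k)%:C * K x w + c w * K x k &
    forall f g, H f -> H g -> (forall x, f x = (val x - val k)%:C * g x) ->
      inner mu f v = (c w)^* * g k].
  move=> wk; have wk0 := valB_neq0 _ _ wk.
  have [G [[HG hG] _]] := division k _ (Hh w) (hk w).
  pose d : R[i] := (val w - val k)%:C.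
  have dJ : (d^-1)^* = d^-1 by rewrite conjV conj_realc.
  exists (fun x => d^-1 * K x w + -1 * G x); split.
  - exact: H2.
  - move=> x; have := hG x; rewrite /h => E.
    transitivity ((val x - val k)%:C / d * K x w - (val x - val k)%:C * G x).
      by ring.
    rewrite -E /d; rewrite !rmorphB /= in wk0 *; field; exact: wk0.
  - move=> f g Hf Hg fg.
    rewrite ip2r// dJ -rep//.
    (* Here <f, G> = <g, h_w> = g(w) - conj(c_w) g(k), while f(w) / (w-k) = g(w), so g(w)
       cancels. *)
    rewrite (inner_mul_sym (mu := mu) fg hG) ip2r// -!rep// fg.
    rewrite /d !conjN conjC1; rewrite !rmorphB /= in wk0 *; field; exact: wk0.
have [v0 [Hv0 _ v0P]] := vP _ w0k.

(* The rank-two formula for (x-w) K(x,w) *)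
pose b x := (val x - val k)%:C * K x k.
(* By the second clause of [vP], a(x) = (x-w0) K(x,w0) / conj(b(w0)). *)
pose a x := ((val x - val k)%:C * v0 x - c w0 * K x k) / (K k k * c w0).
have bJ w : (b w)^* = (val w - val k)%:C * c w * K k k.
  by rewrite /b conjM conj_realc -KJ /c; field.
have [q Lq] : exists q, forall w x,
    (val x - val w)%:C * K x w = a x * (b w)^* + b x * q w.
  suff /choice[q qP] : forall w, exists s, forall x,
      (val x - val w)%:C * K x w = a x * (b w)^* + b x * s by exists q.
  move=> w; have [->|wk] := eqVneq w k.
    (* At w = k the left-hand side is b(x) itself and b(k) = 0. *)
    by exists 1 => x; rewrite bJ subrr !mul0r mulr0 add0r mulr1.
  have [v [Hv vE vip]] := vP _ wk; have wk0 := valB_neq0 _ _ wk.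
  (* The coefficients cancel the two values conj(c) g(k) supplied by [v0P] and [vip]. *)
  pose z x := - c w * v0 x + c w0 * v x.
  have Hz : H z by apply: H2.
  have zperp f : H f -> f k = 0 -> inner mu f z = 0.
    move=> Hf fk; have [g [[Hg fg] _]] := division k f Hf fk.
    by rewrite ip2r// (v0P f g)// (vip f g)// conjN; ring.
  have zE := orth z Hz zperp.
  (* Multiply z = (z(k) / K(k,k)) K_k by (x-k)(w-k) / c_w0 and read off the coefficient of b(x). *)
  exists ((val w - val k)%:C / c w0 * (z k / K k k)) => x.
  have E : c w0 * ((val x - val w)%:C / (val w - val k)%:C * K x w + c w * K x k) =
      (val x - val k)%:C * (c w * v0 x + z k / K k k * K x k).
    by rewrite -vE -zE /z; ring.
  rewrite bJ /a /b; move: E wk0.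
  move: (val x - val w)%:C (val w - val k)%:C (val x - val k)%:C (K x w)
    (z k) (c w) => X D Y t zk cw E D0.
  transitivity (D / c w0 * (c w0 * (X / D * t + cw * K x k)) - D * cw * K x k).
    by field; rewrite D0.
  by rewrite E; field; rewrite Kk.
have skew x w : (val w - val x)%:C * K w x = - ((val x - val w)%:C * K x w)^*.
  by rewrite conjM conj_realc -KJ -mulNr -rmorphN opprB.
have b0 : b w0 != 0 by rewrite mulf_neq0// valB_neq0.
have [A AE] := skew_rank_two (L := fun x w => (val x - val w)%:C * K x w)
  (fun x w => Lq w x) skew b0.
exists A, b => x y xy; rewrite -AE mulrAC divff ?mul1r//.
exact: valB_neq0.
Qed.
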